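(* Let $\mathcal{F}=\{\mathbb{R}^d;f_1,\dots,f_N\}$ and $\mathcal{G}=\{\mathbb{R}^d;g_1,\dots,g_N\}$ be IFSs with $\|f_i(x)-f_i(x')\|=c\|x-x'\|$ and $\|g_i(y)-g_i(y')\|=c\|y-y'\|$ for all $i$ and all $x,x',y,y'\in\mathbb{R}^d$, where $0<c<1$ and $N\ge2$. Let $(p_1,\dots,p_N)$ and $(q_1,\dots,q_N)$ be probability vectors (all entries positive) for $\mathcal{F}$ and $\mathcal{G}$ respectively, and define the weighted IFS $\mathcal{F}\times\mathcal{G}=\{\mathbb{R}^d\times\mathbb{R}^d;\Psi_{ij};p_iq_j:1\le i,j\le N\}$ with $\Psi_{ij}(x,y)=(f_i(x),g_j(y))$. Let $\mu_\mathcal{F},\mu_\mathcal{G},\mu_{\mathcal{F}\times\mathcal{G}}$ be the corresponding invariant measures. If $\mathcal{F}$ and $\mathcal{G}$ satisfy the open set condition, then for every $0<r<\infty$, $$D_r>\max\{D_r^*,D_r'\},$$ where $D_r^*,D_r',D_r$ are the quantization dimensions of order $r$ of $\mu_\mathcal{F},\mu_\mathcal{G},\mu_{\mathcal{F}\times\mathcal{G}}$ respectively.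
   Context: $\mathbb{R}^d\times\mathbb{R}^d=\mathbb{R}^{2d}$ with the Euclidean norm. OSC: there is a nonempty open $U$ with $f_i(U)\subset U$ for all $i$ and $f_i(U)\cap f_j(U)=\emptyset$ for $i\ne j$. Invariant measure of a weighted IFS $\{\theta_k;w_k\}$: unique Borel probability $\nu$ with $\nu=\sum_kw_k\,\nu\circ\theta_k^{-1}$. For a Borel probability $\nu$ on $\mathbb{R}^m$: $V_{n,r}(\nu)=\inf\{\int\operatorname{dist}(z,B)^rd\nu(z):\operatorname{card}B\le n\}$, $e_{n,r}=V_{n,r}^{1/r}$, and the quantization dimension is $D_r(\nu)=\lim_{n\to\infty}\frac{\log n}{-\log e_{n,r}(\nu)}$ (for self-similar measures under OSC this limit exists and is the unique solution $D$ of $\sum_k(w_kc_k^r)^{D/(r+D)}=1$, $c_k$ the similarity ratios). *)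

(* Defs.v *)
From HB Require Import structures.
From mathcomp Require Import all_boot all_order all_algebra.
From mathcomp Require Import all_classical all_reals all_analysis.
Set Implicit Arguments. Unset Strict Implicit. Unset Printing Implicit Defensive.
Import Order.TTheory GRing.Theory Num.Theory.
Import numFieldNormedType.Exports.
Local Open Scope classical_set_scope.
Local Open Scope ring_scope.

Notation Rd R m := (g_sigma_algebraType (@open 'rV[R]_m)).

Definition enorm (R : realType) (m : nat) (x : 'rV[R]_m) : R :=
  Num.sqrt (\sum_(i < m) x 0 i ^+ 2).

Definition similarity (R : realType) (m : nat) (c : R)
  (f : 'rV[R]_m -> 'rV[R]_m) : Prop :=
  forall x x', enorm (f x - f x') = c * enorm (x - x').

Definition OSC (R : realType) (m N : nat) (f : 'I_N -> 'rV[R]_m -> 'rV[R]_m) : Prop :=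
  exists U : set 'rV[R]_m, [/\ open U, U !=set0,
    (forall i, f i @` U `<=` U) &
    (forall i j, i != j -> f i @` U `&` f j @` U = set0)].

Definition pos_prob_vector (R : realType) (N : nat) (p : 'I_N -> R) : Prop :=
  (forall i, 0 < p i) /\ \sum_(i < N) p i = 1.

Definition invariant_measure (R : realType) (m : nat) (K : finType)
  (theta : K -> 'rV[R]_m -> 'rV[R]_m) (w : K -> R)
  (nu : probability (Rd R m) R) : Prop :=
  forall A : set (Rd R m), measurable A ->
    nu A = (\sum_(k : K) (w k)%:E * nu (theta k @^-1` A))%E.

(* dist(z, B) for a finite nonempty set B given as a sequence *)
Definition distB (R : realType) (m : nat) (B : seq 'rV[R]_m) (z : 'rV[R]_m) : R :=
  \big[Order.min/enorm (z - head z B)]_(b <- B) enorm (z - b).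

Definition Vnr (R : realType) (m : nat) (nu : probability (Rd R m) R)
  (n : nat) (r : R) : \bar R :=
  ereal_inf [set (\int[nu]_z ((distB B z) `^ r)%:E)%E
            | B in [set B : seq 'rV[R]_m | (0 < size B <= n)%N]].

Definition enr (R : realType) (m : nat) (nu : probability (Rd R m) R)
  (n : nat) (r : R) : R :=
  (fine (Vnr nu n r)) `^ r^-1.

Definition quant_dim (R : realType) (m : nat) (nu : probability (Rd R m) R)
  (r : R) (D : R) : Prop :=
  (fun n : nat => ln n%:R / (- ln (enr nu n r))) @ \oo --> D.

Definition prod_map (R : realType) (d N : nat)
  (f g : 'I_N -> 'rV[R]_d -> 'rV[R]_d) (ij : 'I_N * 'I_N)
  (z : 'rV[R]_(d + d)) : 'rV[R]_(d + d) :=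
  row_mx (f ij.1 (lsubmx z)) (g ij.2 (rsubmx z)).

(* Main.v *)
(* Put [h_k = w_k c^r] and let [s] in ]0, 1[ solve [sum_k h_k^s = 1]; the quantization dimension of a self-similar measure is then [D = r s / (1 - s)]. For [e = c^(r n)], stop each word [v] as soon as the product [h_v] of the [h_k] along it drops to [e]. The [h_v^s] add up to 1, so there are about [e^-s] such words, and the points [theta_v u] quantize the measure with error [sum_v h_v <= C e^(1 - s)]. Conversely, by the open set condition the points [theta_v u] with [v] of a fixed length [k] are [delta c^k]-separated, so that a code point comes within a multiple of [c^k] of boundedly many of them. Stopped words have at most [n + 1] distinct lengths, hence fewer than a multiple of [e^-s / n] code points miss at least half of the words, and each missed word costs at least [h_v >= C e]. The factor [n] disappears in the logarithmic limit, so the strong open set condition is not needed.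

For the product, [sum_(i, j) (p_i q_j c^r)^t] at the exponent [t < 1] of one factor equals [sum_j q_j^t > 1] (or [sum_i p_i^t > 1]), so the exponent of the product is strictly larger. *)
Require Import Defs.
From HB Require Import structures.
From mathcomp Require Import all_boot all_order all_algebra.
From mathcomp Require Import all_classical all_reals all_analysis.
From mathcomp Require Import measurable_realfun ring lra.
Import Order.TTheory GRing.Theory Num.Theory.
Import numFieldNormedType.Exports.
Local Open Scope classical_set_scope.
Local Open Scope ring_scope.

(** * Euclidean norm, similarities and packing *)

Section EuclideanNorm.
Context {R : realType} {m : nat}.
Implicit Types x y z u v : 'rV[R]_m.

Definition dotr x y : R := \sum_(i < m) x 0 i * y 0 i.

Lemma enorm_ge0 x : 0 <= enorm x.
Proof. exact: sqrtr_ge0. Qed.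

Lemma sqr_enorm x : enorm x ^+ 2 = dotr x x.
Proof.
rewrite sqr_sqrtr; first by apply: eq_bigr => i _; rewrite expr2.
by apply: sumr_ge0 => i _; exact: sqr_ge0.
Qed.

Lemma enorm_le x t : 0 <= t -> (enorm x <= t) = (dotr x x <= t ^+ 2).
Proof. by move=> t0; rewrite -sqr_enorm ler_sqr ?nnegrE// enorm_ge0. Qed.

Lemma dotrDD x y : dotr (x + y) (x + y) = dotr x x + dotr y y + 2 * dotr x y.
Proof.
rewrite /dotr mulr_sumr -!big_split /=; apply: eq_bigr => i _.
by rewrite !mxE; ring.
Qed.

Lemma dotrBB x y : dotr (x - y) (x - y) = dotr x x + dotr y y - 2 * dotr x y.
Proof.
rewrite /dotr mulr_sumr -sumrN -!big_split /=; apply: eq_bigr => i _.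
by rewrite !mxE; ring.
Qed.

(** Lagrange's identity: the double sum of the squares of the 2 by 2 minors is twice the defect of
    the inequality. *)
Lemma dotr_CauchySchwarz x y : dotr x y ^+ 2 <= dotr x x * dotr y y.
Proof.
have : 0 <= \sum_i \sum_j (x 0 i * y 0 j - x 0 j * y 0 i) ^+ 2.
  by apply: sumr_ge0 => i _; apply: sumr_ge0 => j _; exact: sqr_ge0.
suff -> : \sum_i \sum_j (x 0 i * y 0 j - x 0 j * y 0 i) ^+ 2 =
    2 * (dotr x x * dotr y y - dotr x y ^+ 2) by rewrite pmulr_rge0// subr_ge0.
have -> : 2 * (dotr x x * dotr y y - dotr x y ^+ 2) =
    dotr x x * dotr y y + dotr y y * dotr x x - 2 * (dotr x y * dotr x y).
  by ring.
rewrite /dotr !big_distrl /= mulr_sumr -sumrN -!big_split /=.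
apply: eq_bigr => i _.
rewrite !big_distrr /= -sumrN -!big_split /=.
by apply: eq_bigr => j _; ring.
Qed.

Lemma enormD x y : enorm (x + y) <= enorm x + enorm y.
Proof.
rewrite enorm_le ?addr_ge0 ?enorm_ge0// dotrDD sqrrD !sqr_enorm.
rewrite [leRHS]addrAC lerD2l -[leRHS]mulr_natl ler_pM2l//.
apply: (le_trans (ler_norm _)).
rewrite -ler_sqr ?nnegrE ?mulr_ge0 ?enorm_ge0// real_normK ?num_real//.
by rewrite exprMn !sqr_enorm dotr_CauchySchwarz.
Qed.

Lemma enormN x : enorm (- x) = enorm x.
Proof.
by congr Num.sqrt; apply: eq_bigr => i _; rewrite mxE sqrrN.
Qed.

Lemma enormB x y : enorm (x - y) = enorm (y - x).
Proof. by rewrite -enormN opprB. Qed.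

Lemma enorm_dist_triangle z x y : enorm (x - y) <= enorm (x - z) + enorm (z - y).
Proof. by rewrite -[x - y](subrKA z) enormD. Qed.

Lemma normr_le_enorm x i : `|x 0 i| <= enorm x.
Proof.
rewrite -ler_sqr ?nnegrE ?enorm_ge0// sqr_enorm real_normK ?num_real//.
rewrite /dotr (bigD1 i)//= -expr2 lerDl; apply: sumr_ge0 => j _.
by rewrite -expr2 sqr_ge0.
Qed.

(** The crude factor [m.+1] in place of the square root of [m] makes the inequality strict and stays
    nonzero for [m = 0]. *)
Lemma enorm_lt_coord x t : 0 < t -> (forall i, `|x 0 i| <= t) ->
  enorm x < m.+1%:R * t.
Proof.
move=> t0 xt; rewrite -ltr_sqr ?nnegrE ?enorm_ge0 ?mulr_ge0 ?(ltW t0)//.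
rewrite sqr_enorm exprMn; apply: (@le_lt_trans _ _ (\sum_(i < m) t ^+ 2)).
  apply: ler_sum => i _; rewrite -expr2 -[x 0 i ^+ 2]real_normK ?num_real//.
  by rewrite ler_sqr ?nnegrE// ltW.
rewrite sumr_const card_ord -[_ *+ _]mulr_natl ltr_pM2r ?exprn_gt0//.
rewrite -natrX ltr_nat expnS expn1; apply: (leq_trans (ltnSn m)).
exact: leq_pmulr.
Qed.

Lemma enorm0 : enorm (0 : 'rV[R]_m) = 0.
Proof. by rewrite /enorm big1 ?sqrtr0// => i _; rewrite mxE expr0n. Qed.

Lemma enorm_eq0 x : enorm x = 0 -> x = 0.
Proof.
move=> x0; apply/rowP => i; rewrite mxE; apply/eqP; rewrite -normr_le0 -x0.
exact: normr_le_enorm.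
Qed.

(** The ambient topology comes from the maximum norm; it is comparable to [enorm], so openness may
    be tested on Euclidean balls. *)
Lemma open_enormP (A : set 'rV[R]_m) : open A <->
  forall x, A x -> exists2 e : R, 0 < e & forall y, enorm (y - x) < e -> A y.
Proof.
split=> [oA x Ax|H].
  have /nbhs_ballP[e e0 eA] := open_nbhs_nbhs (conj oA Ax).
  exists e => // y yxe; apply: eA; split => // i j.
  rewrite (ord1 i) /ball /= -normrN opprB; apply: le_lt_trans yxe.
  by have := normr_le_enorm (y - x) j; rewrite !mxE.
rewrite openE => x Ax; have [e e0 eA] := H x Ax.
apply/nbhs_ballP; exists (e / m.+1%:R) => /=; first by rewrite divr_gt0.
move=> y [_ xy]; apply: eA.
have := @enorm_lt_coord (y - x) (e / m.+1%:R).
rewrite mulrCA mulfV ?pnatr_eq0// mulr1; apply; first by rewrite divr_gt0.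
move=> i; have := xy 0 i; rewrite /ball /= => /ltW.
by rewrite -normrN opprB !mxE.
Qed.

End EuclideanNorm.

Section Similarity.
Context {R : realType} {m : nat} {c : R} {f : 'rV[R]_m -> 'rV[R]_m}.
Hypothesis c0 : 0 < c.
Hypothesis simf : similarity c f.

(* The rows of [O] are the vectors [f e_i - f 0]. As [f] preserves the inner product up to [c ^+ 2], [O] is invertible and [x] is recovered from [(f x - f 0) *m O^T]. *)
Lemma similarity_surj y : exists x, f x = y.
Proof.
pose F x := f x - f 0.
have FF x : dotr (F x) (F x) = c ^+ 2 * dotr x x.
  by rewrite -!sqr_enorm simf exprMn subr0.
have FB x z : dotr (F x - F z) (F x - F z) = c ^+ 2 * dotr (x - z) (x - z).
  by rewrite -!sqr_enorm /F opprB addrA subrK simf exprMn.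
have dotF x z : dotr (F x) (F z) = c ^+ 2 * dotr x z.
  have := FB x z; rewrite (dotrBB (F x)) (dotrBB x) !FF; lra.
pose O : 'M[R]_m := \matrix_(i < m) F (delta_mx 0 i).
have FO x : F x *m O^T = c ^+ 2 *: x.
  apply/rowP => j; rewrite !mxE.
  transitivity (dotr (F x) (F (delta_mx 0 j))).
    by apply: eq_bigr => i _; rewrite !mxE.
  rewrite dotF /dotr (bigD1 j)//= big1 ?addr0; first by rewrite mxE !eqxx mulr1.
  by move=> i ij; rewrite mxE eqxx (negbTE ij) mulr0.
have c20 : c ^+ 2 != 0 by rewrite expf_neq0// gt_eqF.
have OO : (c ^- 2 *: O) *m O^T = 1%:M.
  apply/row_matrixP => i; rewrite row_mul linearZ /= -scalemxAl.
  by rewrite rowK FO scalerA mulVf// scale1r row1.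
have OOC := mulmx1C OO.
pose x := c ^- 2 *: ((y - f 0) *m O^T).
exists x; apply: (addIr (- f 0)); rewrite -/(F x).
have E : F x *m O^T = (y - f 0) *m O^T by rewrite FO scalerA mulfV// scale1r.
by move/(congr1 (fun u => u *m (c ^- 2 *: O))): E; rewrite -!mulmxA OOC !mulmx1.
Qed.

Lemma similarity_open_preimage (A : set 'rV[R]_m) : open A -> open (f @^-1` A).
Proof.
move=> /open_enormP oA; apply/open_enormP => x /= /oA[e e0 eA].
exists (e / c); first by rewrite divr_gt0.
by move=> y; rewrite ltr_pdivlMr// mulrC -simf => /eA.
Qed.

End Similarity.

Section Packing.
Context {R : realType} {m : nat}.

(* Two points in the same cell of the cubic grid of mesh [delta * t / m.+1] are closer than [delta * t]. *)
Lemma packing (delta rho : R) : 0 < delta -> 0 < rho -> exists M : nat,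
  forall (T : eqType) (pt : T -> 'rV[R]_m) (s : seq T) (b : 'rV[R]_m) (t : R),
    0 < t -> uniq s ->
    {in s &, forall x y, x != y -> delta * t <= enorm (pt x - pt y)} ->
    {in s, forall x, enorm (pt x - b) <= rho * t} ->
    (size s <= M)%N.
Proof.
move=> d0 rho0; pose a := delta / m.+1%:R.
have a0 : 0 < a by rewrite divr_gt0.
pose L := Num.truncn (2 * rho / a).
exists #|{ffun 'I_m -> 'I_L.+1}| => T pt s b t t0 us sep near.
(* Coordinates relative to [b], shifted to be nonnegative and measured in units of the mesh. Since
   mesh and radius both scale with [t], the number of cells does not depend on [t]. *)
pose u x i := (pt x 0 i - b 0 i + rho * t) / (a * t).
pose cell x : {ffun 'I_m -> 'I_L.+1} := [ffun i => inord (Num.truncn (u x i))].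
have at0 : 0 < a * t by rewrite mulr_gt0.
have uP x i : x \in s -> 0 <= u x i <= 2 * rho / a.
  move=> /near xb; have := le_trans (normr_le_enorm (pt x - b) i) xb.
  rewrite !mxE ler_norml => /andP[l1 l2]; apply/andP; split.
    by rewrite divr_ge0 ?(ltW at0)//; lra.
  by rewrite ler_pdivrMr// mulrA divfK ?gt_eqF//; lra.
rewrite -(size_map cell) cardE; apply: uniq_leq_size; last first.
  by move=> z _; rewrite mem_enum.
rewrite map_inj_in_uniq// => x y xs ys exy; apply/eqP/negPn/negP => xy.
have := sep x y xs ys xy; apply/negP; rewrite -ltNge.
have := @enorm_lt_coord R m (pt x - pt y) (a * t) at0.
rewrite mulrA [_ * a]mulrCA mulfV ?pnatr_eq0// mulr1; apply => i.
have trE z : z \in s -> Num.truncn (u z i) = cell z i :> nat.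
  move=> zs; rewrite ffunE inordK// ltnS; have /andP[_ ule] := uP z i zs.
  exact: le_truncn ule.
have /andP[ux0 _] := uP x i xs; have /andP[uy0 _] := uP y i ys.
have := truncn_itv ux0; have := truncn_itv uy0.
rewrite !trE// exy -natr1 => /andP[y1 y2] /andP[x1 x2].
have -> : (pt x - pt y) 0 i = (u x i - u y i) * (a * t).
  by rewrite !mxE /u -mulrBl divfK ?gt_eqF//; ring.
rewrite normrM (gtr0_norm at0) -[leRHS]mul1r ler_pM2r//.
by rewrite ler_norml; apply/andP; split; lra.
Qed.

End Packing.

(** * Words and stopped words *)

(** This is [OSC] over an arbitrary finite index type, because the product system is indexed by
    pairs. *)
Definition open_set_condition {R : realType} {m : nat} {K : finType}
    (theta : K -> 'rV[R]_m -> 'rV[R]_m) : Prop :=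
  exists U : set 'rV[R]_m, [/\ open U, U !=set0,
    (forall i, theta i @` U `<=` U) &
    (forall i j, i != j -> theta i @` U `&` theta j @` U = set0)].

Section Words.
Context {R : realType} {m : nat} {K : finType}.
Context {theta : K -> 'rV[R]_m -> 'rV[R]_m} {c : R}.
Hypothesis c0 : 0 < c.
Hypothesis sim_theta : forall k, similarity c (theta k).

Lemma similarity_foldr (w : seq K) :
  similarity (c ^+ size w) (fun z => foldr theta z w).
Proof.
elim: w => [|k w IH] x y /=; first by rewrite expr0 mul1r.
by rewrite sim_theta IH exprS mulrA.
Qed.

(** The first letters agree because distinct maps send [U] to disjoint sets; injectivity of a
    similarity then cancels this letter. The base points [x] and [y] may differ. *)
Lemma foldr_osc_inj (U : set 'rV[R]_m) :
  (forall i, theta i @` U `<=` U) ->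
  (forall i j, i != j -> theta i @` U `&` theta j @` U = set0) ->
  forall (w v : seq K) (x y : 'rV[R]_m), size w = size v -> U x -> U y ->
    foldr theta x w = foldr theta y v -> w = v.
Proof.
move=> sU dU.
have UU w x : U x -> U (foldr theta x w).
  by move=> Ux; elim: w => //= k w IH; apply: (sU k); exists (foldr theta x w).
elim=> [|k w IH] [|l v] // x y [swv] Ux Uy /= E.
have kl : k = l.
  apply/eqP/negPn/negP => /dU.
  suff : (theta k @` U `&` theta l @` U) (theta k (foldr theta x w)).
    by move=> + E0; rewrite E0.
  split; first by exists (foldr theta x w) => //; exact: UU.
  by exists (foldr theta y v) => //; exact: UU.
rewrite kl in E *; congr cons; apply: (IH v x y) => //.
apply/eqP; rewrite -subr_eq0; apply/eqP/enorm_eq0.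
have := sim_theta l (foldr theta x w) (foldr theta y v).
by rewrite E subrr enorm0 => /esym/eqP; rewrite mulf_eq0 gt_eqF//= => /eqP.
Qed.

Hypothesis osc_theta : open_set_condition theta.

(** Let [U] contain the ball of radius [delta] about [u]. By surjectivity the image of [u] under [v]
    is the image under [w] of some [y]. If the two images of [u] were too close, [y] would lie in
    that ball, hence in [U], forcing [w = v]. *)
Lemma osc_separation : exists (u : 'rV[R]_m) (delta : R), 0 < delta /\
  forall w v : seq K, size w = size v -> w != v ->
    delta * c ^+ size w <= enorm (foldr theta u w - foldr theta u v).
Proof.
have [U [oU [u Uu] sU dU]] := osc_theta.
have /open_enormP/(_ u Uu)[delta d0 dE] := oU.
exists u, delta; split=> // w v swv; rewrite leNgt; apply: contra => close.
have cw0 : 0 < c ^+ size w by rewrite exprn_gt0.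
have [y yE] := similarity_surj cw0 (similarity_foldr w) (foldr theta u v).
apply/eqP; apply: (foldr_osc_inj _ sU dU _ _ y u) => //.
apply: dE; rewrite -(ltr_pM2l cw0) -(similarity_foldr w y u) yE enormB.
by rewrite mulrC.
Qed.

(** For one point [b] and one length, separation and packing leave at most [M] words; there are
    [n.+1] lengths. The point [u] precedes [rho] because the radius is later chosen in terms of
    [u]. *)
Lemma osc_bounded_overlap : exists u : 'rV[R]_m, forall rho : R, 0 < rho ->
  exists M : nat, forall (n : nat) (B : seq 'rV[R]_m) (s : seq (seq K)),
    uniq s -> {in s, forall w, (size w <= n)%N /\ exists2 b, b \in B &
      enorm (foldr theta u w - b) <= rho * c ^+ size w} ->
    (size s <= size B * (n.+1 * M))%N.
Proof.
have [u [delta [d0 sep]]] := osc_separation.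
exists u => rho rho0; have [M MP] := @packing R m delta rho d0 rho0.
exists M => n B s us sP.
pose near (b : 'rV[R]_m) (k : nat) (w : seq K) :=
  (size w == k) && (enorm (foldr theta u w - b) <= rho * c ^+ size w).
have cnt b k : (count (near b k) s <= M)%N.
  rewrite -size_filter.
  apply: (MP _ (fun w => foldr theta u w) _ b (c ^+ k)).
  - by rewrite exprn_gt0.
  - exact: filter_uniq.
  - move=> w v; rewrite !mem_filter => /andP[/andP[/eqP <- _] _].
    by move=> /andP[/andP[/eqP swv _] _]; exact: sep.
  - by move=> w; rewrite mem_filter => /andP[/andP[/eqP <-]].
(* Double counting: every word of [s] is counted at least once, for a close [b] and for [k] its own
   length. *)
apply: (@leq_trans (\sum_(b <- B) \sum_(k < n.+1) count (near b k) s)).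
  under eq_bigr => b _.
    under eq_bigr do rewrite -sum1_count big_mkcond /=.
    rewrite exchange_big /=; over.
  rewrite exchange_big /= -sum1_size big_seq [leqRHS]big_seq.
  apply: leq_sum => w /sP[swn [b bB bw]].
  rewrite (big_rem b)//= (bigD1 (Ordinal (n:=n.+1) (m:=size w) swn))//=.
  by rewrite /near eqxx bw.
rewrite -sum1_size big_distrl /=; apply: leq_sum => b _; rewrite mul1n.
rewrite -[X in (X * M)%N]card_ord -sum_nat_const.
by apply: leq_sum => k _; exact: cnt.
Qed.

End Words.

Section Cut.
Context {R : realType} {K : finType}.

(* The words [w] such that the product of [h] along [w] is at most [e] but exceeds [e] along every proper prefix; [n] bounds the length. *)
Fixpoint cut (h : K -> R) (n : nat) (e : R) : seq (seq K) :=
  if n is n'.+1 then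
    if 1 <= e then [:: [::]]
    else [seq k :: w | k <- enum K, w <- cut h n' (e / h k)]
  else [:: [::]].

Lemma cut_uniq h n e : uniq (cut h n e).
Proof.
elim: n e => [//|n IH] e /=; case: ifP => // _.
apply: allpairs_uniq_dep => //.
- exact: enum_uniq.
- by case=> [x1 x2] [y1 y2] _ _ /= [-> ->].
Qed.

Lemma size_mem_cut h n e w : w \in cut h n e -> (size w <= n)%N.
Proof.
elim: n e w => [|n IH] e w /=; first by rewrite inE => /eqP ->.
case: ifP => _; first by rewrite inE => /eqP ->.
by case/allpairsPdep => k [v [_ /IH vn ->]].
Qed.

Lemma sum_cutS (V : nmodType) (F : seq K -> V) h n e : ~~ (1 <= e) ->
  \sum_(w <- cut h n.+1 e) F w =
  \sum_k \sum_(w <- cut h n (e / h k)) F (k :: w).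
Proof. by move=> /negbTE /= ->; rewrite big_allpairs_dep /= big_enum. Qed.

(** Replacing a word by its one-letter extensions preserves the sum. The weights [a] are independent
    of the [h] that governs stopping; they will be the powers of [h] with exponent [s]. *)
Lemma cut_mass (a h : K -> R) n e : \sum_k a k = 1 ->
  \sum_(w <- cut h n e) \prod_(k <- w) a k = 1.
Proof.
move=> a1; elim: n e => [|n IH] e; first by rewrite big_seq1 big_nil.
have [e1|e1] := boolP (1 <= e); first by rewrite /= e1 big_seq1 big_nil.
rewrite sum_cutS// -[RHS]a1; apply: eq_bigr => k _.
under eq_bigr do rewrite big_cons.
by rewrite -mulr_sumr IH mulr1.
Qed.

(** The condition on [eta ^+ n] ensures that the length bound is not reached before the product has
    dropped to [e]. *)
Lemma cut_prod_le (h : K -> R) (eta : R) n e w :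
  (forall k, 0 < h k <= eta) -> eta ^+ n <= e -> w \in cut h n e ->
  \prod_(k <- w) h k <= e.
Proof.
move=> hP; elim: n e w => [|n IH] e w en.
  by rewrite inE => /eqP ->; rewrite big_nil.
move=> /=; case: ifP => [e1|_]; first by rewrite inE => /eqP ->; rewrite big_nil.
case/allpairsPdep => k [v [_ vin ->]]; have /andP[hk0 hke] := hP k.
rewrite big_cons mulrC -ler_pdivlMr//; apply: IH vin.
rewrite ler_pdivlMr//; apply: le_trans en; rewrite exprSr ler_wpM2l//.
by rewrite exprn_ge0// (le_trans (ltW hk0)).
Qed.

(** Before its last letter the product still exceeded [e], and that letter costs a factor of at
    least [hmin]. The condition [e * hmin <= 1] settles the empty word. *)
Lemma cut_prod_ge (h : K -> R) (hmin : R) n e w :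
  0 < hmin -> (forall k, hmin <= h k) ->
  e * hmin <= 1 -> w \in cut h n e -> e * hmin <= \prod_(k <- w) h k.
Proof.
move=> hmin0 hm; have h0 k := lt_le_trans hmin0 (hm k).
elim: n e w => [|n IH] e w en.
  by rewrite inE => /eqP ->; rewrite big_nil.
move=> /=; case: ifP => [_|/negbT]; first by rewrite inE => /eqP ->; rewrite big_nil.
rewrite -ltNge => e1; case/allpairsPdep => k [v [_ vin ->]].
rewrite big_cons -ler_pdivrMl// mulrA [_^-1 * _]mulrC; apply: IH vin.
rewrite mulrAC ler_pdivrMr// mul1r (le_trans _ (hm k))//.
by rewrite ler_piMl// ltW.
Qed.

End Cut.

(** * Invariant measures *)

Section DistB.
Context {R : realType} {m : nat}.
Implicit Types (B : seq 'rV[R]_m) (z b : 'rV[R]_m).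

Lemma distB_le B z b : b \in B -> distB B z <= enorm (z - b).
Proof.
rewrite /distB; move: (enorm (z - head z B)) => a.
elim: B => // a' B IH; rewrite inE big_cons ge_min => /orP[/eqP ->|/IH ->].
  by rewrite lexx.
by rewrite orbT.
Qed.

(** The list is written [b :: B] because for the empty list [distB] takes the value [enorm (z - z)],
    which is 0. *)
Lemma distB_ge b B z t : (forall a, a \in b :: B -> t <= enorm (z - a)) ->
  t <= distB (b :: B) z.
Proof.
rewrite /distB /= => tB; have tb : t <= enorm (z - b) by apply: tB; rewrite mem_head.
elim: (b :: B) tB => [|a A IH] tA; first by rewrite big_nil.
rewrite big_cons le_min tA ?mem_head// IH// => a' a'A.
by apply: tA; rewrite inE a'A orbT.
Qed.

Lemma distB_ge0 B z : 0 <= distB B z.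
Proof.
case: B => [|b B]; first by rewrite /distB big_nil enorm_ge0.
by apply: distB_ge => a _; exact: enorm_ge0.
Qed.

End DistB.

Lemma exists_expr_lt {R : realType} (x y : R) : (0 < x < 1) -> (0 < y) ->
  exists n, (x ^+ n < y).
Proof.
move=> /andP[x0 x1] y0.
have /cvgrPdist_lt/(_ y y0)[n _ /(_ n (leqnn n))] : x ^+ n @[n --> \oo] --> (0 : R).
  by apply: cvg_expr; rewrite gtr0_norm.
by rewrite sub0r normrN ger0_norm ?exprn_ge0 ?(ltW x0)// => ?; exists n.
Qed.

Section InvariantMeasure.
Context {R : realType} {m : nat} {K : finType}.
Context {theta : K -> 'rV[R]_m -> 'rV[R]_m} {c : R} {w : K -> R}.
Context {nu : probability (Rd R m) R}.
Hypothesis c01 : 0 < c < 1.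
Hypothesis sim_theta : forall k, similarity c (theta k).
Hypothesis w0 : forall k, 0 < w k.
Hypothesis w1 : \sum_k w k = 1.
Hypothesis inv_nu : invariant_measure theta w nu.

Lemma measurable_enormB (b : 'rV[R]_m) :
  measurable_fun setT (fun z : Rd R m => enorm (z - b)).
Proof.
apply: (measurability _ (RGenOpens.measurableE _)).
move=> _ [_ [x [y ->]] <-]; rewrite setTI; apply: sub_sigma_algebra.
apply/open_enormP => z /=; rewrite in_itv/= => /andP[xz zy].
exists (Num.min (enorm (z - b) - x) (y - enorm (z - b))).
  by rewrite lt_min !subr_gt0 xz.
move=> v; rewrite lt_min /= in_itv/= => /andP[v1 v2].
have := enorm_dist_triangle z v b; have := enorm_dist_triangle v z b.
rewrite (enormB z v) => t1 t2; apply/andP; split; lra.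
Qed.

Lemma measurable_distB (b : 'rV[R]_m) (B : seq 'rV[R]_m) :
  measurable_fun setT (fun z : Rd R m => distB (b :: B) z).
Proof.
rewrite /distB /=; elim: (b :: B) => [|a A IH].
  by under eq_fun do rewrite big_nil; exact: measurable_enormB.
under eq_fun do rewrite big_cons.
by apply: measurable_minr => //; exact: measurable_enormB.
Qed.

Lemma measurable_similarity k :
  measurable_fun (setT : set (Rd R m)) (theta k : Rd R m -> Rd R m).
Proof.
have /andP[c0 _] := c01.
have := @measurability _ _ (Rd R m) (Rd R m) setT (theta k) (@open 'rV[R]_m) erefl.
apply.
move=> _ [A oA <-]; rewrite setTI; apply: sub_sigma_algebra.
exact: similarity_open_preimage (sim_theta k) _ oA.
Qed.

Local Open Scope ereal_scope.

Lemma integral_invariant (phi : Rd R m -> \bar R) :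
  measurable_fun setT phi -> (forall z, 0 <= phi z) ->
  \int[nu]_z phi z = \sum_k (w k)%:E * \int[nu]_z phi (theta k z).
Proof.
move=> mphi phi0.
pose wn (k : K) : {nonneg R} := NngNum (ltW (w0 k)).
have [k0 _|K0] := pickP (@predT K); last first.
  have := inv_nu _ measurableT; rewrite probability_setT big_pred0//.
  by move/eqP; rewrite eqe oner_eq0.
pose push k : {measure set (Rd R m) -> \bar R} :=
  pushforward nu (theta k : Rd R m -> Rd R m).
(* Invariance says that [nu] is a weighted sum of push-forwards. Finite sums of measures are indexed
   by natural numbers, so [K] is enumerated, with [k0] as the default of [nth]. *)
pose mm (i : nat) : {measure set (Rd R m) -> \bar R} :=
  let k := nth k0 (enum K) i in mscale (wn k) (push measurable_similarity k).
rewrite (eq_measure_integral (msum mm #|K|)) => [|A mA _].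
  rewrite ge0_integral_measure_sum//.
  transitivity (\sum_(k <- enum K) (w k)%:E * \int[nu]_z phi (theta k z)); last first.
    by rewrite big_enum.
  rewrite (big_nth k0) -cardE big_mkord; apply: eq_bigr => i _.
  rewrite ge0_integral_mscale// ge0_integral_pushforward//.
  exact: measurable_similarity.
rewrite /msum; transitivity (\sum_(k <- enum K) (w k)%:E * nu (theta k @^-1` A)).
  by rewrite big_enum; exact: inv_nu.
by rewrite (big_nth k0) -cardE big_mkord; apply: eq_bigr.
Qed.

Lemma measurable_foldr (v : seq K) :
  measurable_fun (setT : set (Rd R m)) (fun z : Rd R m => foldr theta z v : Rd R m).
Proof.
elim: v => [|k v IH]; first exact: measurable_id.
exact: measurableT_comp (measurable_similarity k) IH.
Qed.

Lemma integral_cut (h : K -> R) n e (phi : Rd R m -> \bar R) :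
  measurable_fun setT phi -> (forall z, 0 <= phi z) ->
  \int[nu]_z phi z = \sum_(v <- cut h n e)
    (\prod_(k <- v) w k)%:E * \int[nu]_z phi (foldr theta z v).
Proof.
elim: n e phi => [|n IH] e phi mphi phi0; first by rewrite big_seq1 big_nil mul1e.
have [e1|e1] := boolP (1 <= e)%R; first by rewrite /= e1 big_seq1 big_nil mul1e.
rewrite sum_cutS// integral_invariant//; apply: eq_bigr => k _.
have mphik : measurable_fun setT (phi \o theta k : Rd R m -> _).
  exact: measurableT_comp mphi (measurable_similarity k).
rewrite (IH (e / h k)%R _ mphik) => [|z]; last exact: phi0.
rewrite ge0_sume_distrr => [|v _].
  by apply: eq_bigr => v _; rewrite big_cons EFinM muleA.
apply: mule_ge0; last by apply: integral_ge0 => z _; exact: phi0.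
by rewrite lee_fin big_seq prodr_ge0// => l _; exact: ltW.
Qed.

(** Invariance and contraction bound the mass outside a ball by the mass outside ever larger balls,
    which tends to 0. This yields boundedness without constructing the attractor. *)
Lemma invariant_measure_bounded (u : 'rV[R]_m) :
  exists2 rho : R, (0 < rho)%R & {ae nu, forall z, (enorm (z - u) <= rho)%R}.
Proof.
have /andP[c0 c1] := c01.
pose A t : set (Rd R m) := [set z | (t < enorm (z - u))%R].
have mA t : measurable (A t).
  have -> : A t = (fun z : Rd R m => enorm (z - u)) @^-1` `]t, +oo[.
    by apply/seteqP; split=> z /=; rewrite /A/= in_itv/= andbT.
  by rewrite -[X in measurable X]setTI; apply: measurable_enormB.
(* Chosen so that every [theta k] maps the ball of radius [rho] about [u] into itself; the sum
   stands in for a maximum. *)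
pose rho := ((\sum_k enorm (theta k u - u)) / (1 - c))%R.
have c1' : (0 < 1 - c)%R by rewrite subr_gt0.
have rho0 : (0 <= rho)%R.
  by rewrite divr_ge0 ?(ltW c1')// sumr_ge0// => k _; exact: enorm_ge0.
have thu k : (enorm (theta k u - u) <= rho * (1 - c))%R.
  rewrite divfK ?gt_eqF// (bigD1 k)//= lerDl sumr_ge0// => l _.
  exact: enorm_ge0.
(* If [theta k z] is farther than [rho + t] from [u], then [z] is farther than [rho + t / c]. *)
have step t : nu (A (rho + t)%R) <= nu (A (rho + t / c)%R).
  rewrite inv_nu//; apply: (@le_trans _ _ (\sum_k (w k)%:E * nu (A (rho + t / c)%R))).
    apply: lee_sum => k _; rewrite lee_pmul2l ?lte_fin//.
    apply: le_measure; rewrite ?inE//.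
      rewrite -[X in measurable X]setTI.
      by apply: (measurable_similarity k).
    move=> z /= tz; have := enorm_dist_triangle (theta k u) (theta k z) u.
    rewrite (sim_theta k) => tri; have := thu k; rewrite /A /= in tz *.
    move=> le1; rewrite -ltrBrDl ltr_pdivrMr//; lra.
  rewrite -ge0_sume_distrl; last by move=> k _; rewrite lee_fin ltW.
  by rewrite sumEFin w1 mul1e.
have steps n : nu (A (rho + 1)%R) <= nu (A (rho + c ^- n)%R).
  elim: n => [|n IH]; first by rewrite expr0 invr1.
  apply: (le_trans IH); apply: (le_trans (step _)).
  by rewrite exprSr invfM.
have nuA0 : nu (A (rho + 1)%R) = 0.
  pose F n := A (n%:R : R).
  have Fcvg : nu (F n) @[n --> \oo] --> 0.
    have -> : 0 = nu (\bigcap_n F n).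
      suff -> : \bigcap_n F n = set0 by rewrite measure0.
      apply/seteqP; split=> // z /(_ (Num.truncn (enorm (z - u))).+1 I).
      rewrite /F/A/=; apply/negP; rewrite -leNgt ltW//.
      by have /andP[] := truncn_itv (enorm_ge0 (z - u)).
    apply: nonincreasing_cvg_mu.
    - by rewrite (le_lt_trans (probability_le1 _ _))// ?ltry//; exact: mA.
    - by move=> n; exact: mA.
    - by apply: bigcap_measurable => // n _; exact: mA.
    - apply/nonincreasing_seqP => n; rewrite subsetEset => z; rewrite /F/A/=.
      by apply: le_lt_trans; rewrite ler_nat.
  apply/eqP; rewrite eq_le measure_ge0 andbT.
  rewrite -(cvg_lim _ Fcvg)//; apply: lime_ge; first by apply/cvg_ex; exists 0.
  apply: nearW => n.
  have [j jP] := @exists_expr_lt R c (n.+1%:R^-1) c01 ltac:(by rewrite invr_gt0).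
  apply: (le_trans (steps j)); apply: le_measure; rewrite ?inE; [exact: mA..|].
  move=> z; rewrite /F/A/=; apply: lt_trans.
  have : (n.+1%:R < c ^- j)%R by rewrite -[ltLHS]invrK ltf_pV2 ?posrE ?exprn_gt0 ?invr_gt0.
  rewrite -natr1; lra.
exists (rho + 1)%R; first by rewrite ltr_wpDl.
exists (A (rho + 1)%R); split => //.
by move=> z /= /negP; rewrite -ltNge.
Qed.

End InvariantMeasure.

(** * Bounds on the quantization error *)

Lemma prod_powR {R : realType} {I : Type} (F : I -> R) (x : R) (v : seq I) :
  (forall i, 0 <= F i) ->
  \prod_(i <- v) F i `^ x = (\prod_(i <- v) F i) `^ x.
Proof.
move=> F0; elim: v => [|i v IH]; first by rewrite !big_nil powR1.
by rewrite !big_cons IH powRM// prodr_ge0.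
Qed.

Section QuantizationBounds.
Context {R : realType} {m : nat} {K : finType}.
Context {theta : K -> 'rV[R]_m -> 'rV[R]_m} {c r : R} {w : K -> R}.
Context {nu : probability (Rd R m) R}.
Hypothesis c01 : 0 < c < 1.
Hypothesis r0 : 0 < r.
Hypothesis sim_theta : forall k, similarity c (theta k).
Hypothesis w0 : forall k, 0 < w k.
Hypothesis w1 : \sum_k w k = 1.
Hypothesis inv_nu : invariant_measure theta w nu.

Let h k := w k * c `^ r.

Let c_gt0 : 0 < c. Proof. by have /andP[] := c01. Qed.

Let prod_h (v : seq K) :
  \prod_(k <- v) h k = \prod_(k <- v) w k * (c ^+ size v) `^ r.
Proof.
elim: v => [|k v IH]; first by rewrite !big_nil expr0 powR1 mulr1.
rewrite !big_cons IH /= exprS powRM ?(ltW c_gt0) ?exprn_ge0 ?(ltW c_gt0)//.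
by rewrite /h; ring.
Qed.

Lemma measurable_distB_powR (B : seq 'rV[R]_m) : (0 < size B)%N ->
  measurable_fun setT (fun z : Rd R m => (distB B z `^ r)%:E).
Proof.
case: B => // b B _; apply/measurable_EFinP.
exact: (measurableT_comp (measurable_powR r) (measurable_distB b B)).
Qed.

Context {u : 'rV[R]_m} {rho : R}.
Hypothesis rho0 : 0 < rho.
Hypothesis nu_rho : {ae nu, forall z, enorm (z - u) <= rho}.

Lemma integral_distB_cut (B : seq 'rV[R]_m) n e : (0 < size B)%N ->
  (\int[nu]_z (distB B z `^ r)%:E = \sum_(v <- cut h n e)
    (\prod_(k <- v) w k)%:E * \int[nu]_z (distB B (foldr theta z v) `^ r)%:E)%E.
Proof.
move=> B0; apply: (integral_cut c01 sim_theta w0 inv_nu h n e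
  (fun z : Rd R m => (distB B z `^ r)%:E)).
- exact: measurable_distB_powR.
- by move=> z; rewrite lee_fin powR_ge0.
Qed.

Lemma measurable_distB_foldr (B : seq 'rV[R]_m) (v : seq K) : (0 < size B)%N ->
  measurable_fun setT (fun z : Rd R m => (distB B (foldr theta z v) `^ r)%:E).
Proof.
move=> B0.
exact: (measurableT_comp (measurable_distB_powR B B0)
  (measurable_foldr c01 sim_theta v)).
Qed.

(** The code consists of the images of [u] under the stopped words. On the piece of [v] the distance
    is at most [rho * c ^+ size v], and its power [r] times the weight of [v] gives the product of
    [h]. *)
Lemma Vnr_le_cut n e N : (0 < size (cut h n e) <= N)%N ->
  (Vnr nu N r <= (rho `^ r * \sum_(v <- cut h n e) \prod_(k <- v) h k)%:E)%E.
Proof.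
move=> sN; pose B := [seq foldr theta u v | v <- cut h n e].
have B0 : (0 < size B)%N by rewrite size_map; case/andP: sN.
apply: (@le_trans _ _ (\int[nu]_z (distB B z `^ r)%:E)%E).
  by apply: ereal_inf_lbound; exists B => //=; rewrite size_map.
rewrite (integral_distB_cut B n e B0) mulr_sumr -sumEFin big_seq [leRHS]big_seq.
apply: lee_sum => v vin; rewrite prod_h mulrCA EFinM.
have pw0 : (0 <= (\prod_(k <- v) w k)%:E)%E by rewrite lee_fin prodr_ge0// => k _; exact: ltW.
apply: lee_wpmul2l => //.
set a : R := rho `^ r * _.
have -> : a%:E = (\int[nu]_z cst a%:E z)%E.
  by rewrite integral_cst//= [X in (_ * X)%E](probability_setT nu) mule1.
apply: ae_ge0_le_integral => //.
- by move=> z _; rewrite lee_fin powR_ge0.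
- exact: measurable_distB_foldr.
- by move=> z _; rewrite lee_fin mulr_ge0// powR_ge0.
case: nu_rho => N0 [mN0 nuN0 N0P]; exists N0; split => // z.
apply: contra_notP => /(contra_notP (N0P z)) zu _.
rewrite lee_fin /a.
have cv0 : 0 <= c ^+ size v by rewrite exprn_ge0// ltW.
rewrite -powRM ?(ltW rho0)//; apply: ge0_ler_powR; rewrite ?nnegrE ?(ltW r0) ?distB_ge0//.
  by rewrite mulr_ge0// ltW.
apply: (@le_trans _ _ (enorm (foldr theta z v - foldr theta u v))).
  by apply: distB_le; apply: map_f.
by rewrite (similarity_foldr sim_theta v z u) mulrC ler_wpM2r.
Qed.

(** The piece of [v] lies almost surely within [rho * c ^+ size v] of the image of [u]. A code that
    avoids the radius with factor [rho + 1] therefore stays at distance [c ^+ size v] from the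
    piece, which costs the product of [h] along [v]. *)
Lemma Vnr_ge_cut n e N (b : R) :
  (forall B : seq 'rV[R]_m, (0 < size B <= N)%N ->
    b <= \sum_(v <- cut h n e | all (fun a =>
      (rho + 1) * c ^+ size v <= enorm (foldr theta u v - a)) B) \prod_(k <- v) h k) ->
  (b%:E <= Vnr nu N r)%E.
Proof.
move=> bP; apply: le_ereal_inf_tmp => _ [B BN <-].
have /andP[B0 _] := BN.
have := bP B BN; rewrite -lee_fin => /le_trans; apply.
rewrite (integral_distB_cut B n e B0) -sumEFin big_mkcond big_seq [leRHS]big_seq /=.
apply: lee_sum => v vin.
have pw0 : (0 <= (\prod_(k <- v) w k)%:E)%E by rewrite lee_fin prodr_ge0// => k _; exact: ltW.
case: ifPn => [/allP good|_]; last first.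
  by apply: mule_ge0 => //; apply: integral_ge0 => z _; rewrite lee_fin powR_ge0.
rewrite prod_h EFinM; apply: lee_wpmul2l => //.
set a : R := _ `^ r.
have -> : a%:E = (\int[nu]_z cst a%:E z)%E.
  by rewrite integral_cst//= [X in (_ * X)%E](probability_setT nu) mule1.
have cv0 : 0 <= c ^+ size v by rewrite exprn_ge0// ltW.
apply: ae_ge0_le_integral => //.
- by move=> z _; rewrite lee_fin powR_ge0.
- by move=> z _; rewrite lee_fin powR_ge0.
- exact: measurable_distB_foldr.
case: nu_rho => N0 [mN0 nuN0 N0P]; exists N0; split => // z.
apply: contra_notP => /(contra_notP (N0P z)) zu _.
rewrite lee_fin /a.
apply: ge0_ler_powR; rewrite ?nnegrE ?(ltW r0) ?distB_ge0//.
case: B B0 good {bP BN} => // b' B _ good; apply: distB_ge => x xB.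
have := enorm_dist_triangle (foldr theta z v) (foldr theta u v) x.
rewrite enormB (enormB (foldr theta u v)) (similarity_foldr sim_theta v z u).
have := good x xB; have := ler_wpM2l cv0 zu.
rewrite enormB (enormB (foldr theta z v) x); lra.
Qed.

End QuantizationBounds.

Section QuantizationExponent.
Context {R : realType} {m : nat} {K : finType}.
Context {theta : K -> 'rV[R]_m -> 'rV[R]_m} {c r s : R} {w : K -> R}.
Context {nu : probability (Rd R m) R}.
Hypothesis c01 : 0 < c < 1.
Hypothesis r0 : 0 < r.
Hypothesis sim_theta : forall k, similarity c (theta k).
Hypothesis w0 : forall k, 0 < w k.
Hypothesis w1 : \sum_k w k = 1.
Hypothesis inv_nu : invariant_measure theta w nu.
Hypothesis s01 : 0 < s < 1.
Hypothesis sum_s : \sum_k (w k * c `^ r) `^ s = 1.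

Let h k := w k * c `^ r.
Let eta := c `^ r.

Let eta0 : 0 < eta. Proof. by rewrite powR_gt0//; have /andP[] := c01. Qed.

Let h0 k : 0 < h k. Proof. by rewrite mulr_gt0. Qed.

Let h_eta k : 0 < h k <= eta.
Proof.
rewrite h0 ger_pMl// -w1 (bigD1 k)//= lerDl.
by apply: sumr_ge0 => l _; exact: ltW.
Qed.

Let eta1 : eta <= 1.
Proof.
have /andP[/ltW c0' /ltW c1'] := c01.
suff : c `^ r <= 1 `^ r by rewrite powR1.
by apply: ge0_ler_powR; rewrite ?nnegrE// ltW.
Qed.

(** The full product serves as a common lower bound, since every factor is at most 1. *)
Let hmin := \prod_k h k.

Let hmin0 : 0 < hmin. Proof. by rewrite prodr_gt0. Qed.

Let hmin_le k : hmin <= h k.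
Proof.
rewrite /hmin (bigD1 k)//= ger_pMr//.
apply: prodr_ile1 => l _; rewrite ltW//=.
by have /andP[_ /le_trans] := h_eta l; apply.
Qed.

Let e n := eta ^+ n.
(** Each letter contributes a factor of at most [eta], so [n] letters always bring the product down
    to [eta ^+ n]: the length bound matches the threshold. *)
Let Gamma n := cut h n (e n).

Let e0 n : 0 < e n. Proof. by rewrite exprn_gt0. Qed.

Let es0 n x : 0 < e n `^ x. Proof. by rewrite powR_gt0. Qed.

Let e_split n : e n = e n `^ s * e n `^ (1 - s).
Proof.
by rewrite -powRD ?(gt_eqF (e0 n)) ?implybT// subrKC powRr1// ltW.
Qed.

Let e_hmin n : e n * hmin <= 1.
Proof.
have [k0 _|K0] := pickP (@predT K); last first.
  by move/eqP: w1; rewrite big_pred0// eq_sym oner_eq0.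
rewrite mulr_ile1// ?(ltW hmin0) ?(ltW (e0 n))//; first by rewrite exprn_ile1// ltW.
by rewrite (le_trans (hmin_le k0))//; have /andP[_ /le_trans] := h_eta k0; apply.
Qed.

Let prod_le n v : v \in Gamma n -> \prod_(k <- v) h k <= e n.
Proof. by apply: cut_prod_le => //; exact: h_eta. Qed.

Let prod_ge n v : v \in Gamma n -> e n * hmin <= \prod_(k <- v) h k.
Proof. by apply: cut_prod_ge => //; exact: e_hmin. Qed.

Let mass n : \sum_(v <- Gamma n) (\prod_(k <- v) h k) `^ s = 1.
Proof.
rewrite -[RHS](cut_mass (fun k => h k `^ s) h n (e n) sum_s).
by apply: eq_bigr => v _; rewrite prod_powR// => k; exact: ltW.
Qed.

Let prod_ge0 v : 0 <= \prod_(k <- v) h k.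
Proof. by rewrite prodr_ge0// => k _; exact: ltW. Qed.

Let sum_const n (x : R) : \sum_(v <- Gamma n) x = (size (Gamma n))%:R * x.
Proof. by rewrite big_const_seq count_predT iter_addr_0 mulr_natl. Qed.

(** In [mass] every term lies between the powers with exponent [s] of [e n * hmin] and of [e n]; the
    two bounds on the number of words follow. *)
Let size_ge n : 1 <= (size (Gamma n))%:R * e n `^ s.
Proof.
have /andP[s0 _] := s01.
rewrite -[leLHS](mass n) -sum_const big_seq [leRHS]big_seq; apply: ler_sum => v vG.
by apply: ge0_ler_powR; rewrite ?nnegrE ?(ltW s0) ?(ltW (e0 n))// prod_le.
Qed.

Let size_le n : (size (Gamma n))%:R * (e n * hmin) `^ s <= 1.
Proof.
have /andP[s0 _] := s01.
rewrite -[leRHS](mass n) -sum_const big_seq [leRHS]big_seq; apply: ler_sum => v vG.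
apply: ge0_ler_powR; rewrite ?nnegrE ?(ltW s0)//; last exact: prod_ge.
by rewrite mulr_ge0// ltW.
Qed.

Let size_gt0 n : (0 < size (Gamma n))%N.
Proof.
rewrite lt0n; apply: contraTneq (size_ge n) => ->.
by rewrite mul0r -ltNge.
Qed.

(** The condition on [N] makes room for all stopped words. Splitting each product into its powers
    [s] and [1 - s], the first add up to 1 and the second are bounded through [e n]. *)
Lemma Vnr_upper_bound : exists C A : R, [/\ 0 < C, 0 < A &
  forall n N, A <= N%:R * (eta ^+ n) `^ s ->
    (Vnr nu N r <= (C * (eta ^+ n) `^ (1 - s))%:E)%E].
Proof.
have [rho rho0 nu_rho] := invariant_measure_bounded c01 sim_theta w0 w1 inv_nu 0.
exists (rho `^ r), (hmin `^ s)^-1; split; rewrite ?invr_gt0 ?powR_gt0//.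
move=> n N AN; have sN : (0 < size (Gamma n) <= N)%N.
  rewrite size_gt0/= -(ler_nat R).
  have hs : 0 < e n `^ s * hmin `^ s by rewrite mulr_gt0// powR_gt0.
  rewrite -(ler_pM2r hs) -powRM ?(ltW hmin0) ?(ltW (e0 n))//.
  apply: (le_trans (size_le n)).
  rewrite powRM ?(ltW hmin0) ?(ltW (e0 n))// mulrA -ler_pdivrMr ?powR_gt0//.
  by rewrite mul1r.
apply: (le_trans (Vnr_le_cut c01 r0 sim_theta w0 inv_nu rho0 nu_rho _ _ _ sN)).
rewrite lee_fin ler_wpM2l ?powR_ge0// -[leRHS]mul1r -[X in _ <= X * _](mass n) mulr_suml.
rewrite big_seq [leRHS]big_seq; apply: ler_sum => v vG.
have v0 : 0 < \prod_(k <- v) h k by rewrite prodr_gt0.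
rewrite -{1}[\prod_(k <- v) _]powRr1 ?(ltW v0)// -[X in _ `^ X](subrKC s).
rewrite powRD ?(gt_eqF v0) ?implybT// ler_wpM2l ?powR_ge0//.
have /andP[_ s1] := s01.
by apply: ge0_ler_powR; rewrite ?nnegrE ?subr_ge0 ?(ltW s1) ?(ltW v0) ?(ltW (e0 n)) ?prod_le.
Qed.

Hypothesis osc_theta : open_set_condition theta.

(** The constant [A] is chosen so that the words near the code account for at most 1/2 after
    multiplication by the power [s] of [e n]. The remaining words account for at least 1/2, and each
    costs at least [e n * hmin]. *)
Lemma Vnr_lower_bound : exists C A : R, [/\ 0 < C, 0 < A &
  forall n N, N%:R * n.+1%:R * (eta ^+ n) `^ s <= A ->
    ((C * (eta ^+ n) `^ (1 - s))%:E <= Vnr nu N r)%E].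
Proof.
have /andP[c0 _] := c01.
have [u uP] := osc_bounded_overlap c0 sim_theta osc_theta.
have [rho rho0 nu_rho] := invariant_measure_bounded c01 sim_theta w0 w1 inv_nu u.
have [M MP] := uP (rho + 1) (ltr_wpDl (ltW rho0) ltr01).
exists (hmin / 2), (2 * M.+1%:R)^-1; split; rewrite ?invr_gt0 ?divr_gt0 ?mulr_gt0//.
move=> n N NA.
apply: (Vnr_ge_cut c01 r0 sim_theta w0 inv_nu nu_rho n (e n)) => B /andP[B0 BN].
pose good v := all (fun a => (rho + 1) * c ^+ size v <= enorm (foldr theta u v - a)) B.
rewrite -big_filter -/(Gamma n) -/good.
have bad_le : (size (seq.filter (predC good) (Gamma n)) <= N * (n.+1 * M))%N.
  apply: (@leq_trans (size B * (n.+1 * M))); last by rewrite leq_mul2r BN orbT.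
  apply: MP; first by rewrite filter_uniq// cut_uniq.
  move=> v; rewrite mem_filter /= => /andP[/allPn[b bB bv] vG]; split.
    exact: size_mem_cut vG.
  by exists b => //; rewrite ltW// ltNge.
have sizeE : (size (Gamma n))%:R =
    (size (seq.filter good (Gamma n)))%:R + (size (seq.filter (predC good) (Gamma n)))%:R :> R.
  by rewrite -natrD !size_filter count_predC.
have good_ge : 2^-1 <= (size (seq.filter good (Gamma n)))%:R * e n `^ s.
  have : (size (seq.filter (predC good) (Gamma n)))%:R * e n `^ s <= 2^-1.
    apply: (@le_trans _ _ (N%:R * n.+1%:R * (eta ^+ n) `^ s * M.+1%:R)).
      rewrite mulrAC ler_pM2r// -!natrM ler_nat; apply: (leq_trans bad_le).
      by rewrite -mulnA leq_mul2l leq_mul2l leqnSn !orbT.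
    by move: NA; rewrite invfM ler_pdivlMr.
  have := size_ge n; rewrite sizeE mulrDl; lra.
apply: (@le_trans _ _ (\sum_(v <- seq.filter good (Gamma n)) (e n * hmin))).
  rewrite big_const_seq count_predT iter_addr_0 -[leRHS]mulr_natl [in leRHS]e_split.
  rewrite -/(e n) [leLHS](_ : _ = 2^-1 * (e n `^ (1 - s) * hmin)); last by ring.
  by rewrite [in leRHS]mulrA mulrA mulrA !ler_pM2r.
rewrite big_seq [leRHS]big_seq; apply: ler_sum => v.
by rewrite mem_filter => /andP[_]; exact: prod_ge.
Qed.

End QuantizationExponent.

(** * Quantization dimension *)

Section Asymptotics.
Context {R : realType} {m : nat} {nu : probability (Rd R m) R} {r s eta : R}.
Hypothesis r0 : 0 < r.
Hypothesis s01 : 0 < s < 1.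
Hypothesis eta01 : 0 < eta < 1.
Hypothesis upper : exists C A : R, [/\ 0 < C, 0 < A &
  forall n N, A <= N%:R * (eta ^+ n) `^ s ->
    (Vnr nu N r <= (C * (eta ^+ n) `^ (1 - s))%:E)%E].
Hypothesis lower : exists C A : R, [/\ 0 < C, 0 < A &
  forall n N, N%:R * n.+1%:R * (eta ^+ n) `^ s <= A ->
    ((C * (eta ^+ n) `^ (1 - s))%:E <= Vnr nu N r)%E].

Let V N := fine (Vnr nu N r).
Let L := - ln eta.

Let s0 : 0 < s. Proof. by have /andP[] := s01. Qed.
Let s1 : 0 < 1 - s. Proof. by rewrite subr_gt0; have /andP[] := s01. Qed.
Let eta0 : 0 < eta. Proof. by have /andP[] := eta01. Qed.
Let L0 : 0 < L. Proof. by rewrite oppr_gt0 ln_lt0. Qed.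

Let ln_eta n x : ln ((eta ^+ n) `^ x) = - (n%:R * x * L).
Proof. by rewrite ln_powR lnXn// -mulr_natl /L; ring. Qed.

Let etan0 n x : 0 < (eta ^+ n) `^ x.
Proof. by rewrite powR_gt0// exprn_gt0. Qed.

Let ler_lnE (x y : R) : 0 < x -> 0 < y -> (x <= y) = (ln x <= ln y).
Proof. by move=> x0 y0; rewrite ler_ln ?posrE. Qed.

Let archi (x : R) : exists n : nat, x <= n%:R.
Proof. by exists (Num.truncn x).+1; rewrite ltW// truncnS_gt. Qed.

(* [s'] in place of [s] absorbs the factor [n.+1] of the lower bound. *)
Let lnV_ge s' : 0 < s' < s -> exists C : R, forall N, (0 < N)%N ->
  [/\ exists2 b : R, 0 < b & (b%:E <= Vnr nu N r)%E &
      (Vnr nu N r < +oo)%E -> - ln (V N) <= (1 - s) / s' * ln N%:R + C].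
Proof.
move=> /andP[s'0 s's]; have [C [A [C0 A0 lowerP]]] := lower.
(* The bound [ln y < y] at [y = n.+1 * a] gives [ln n.+1 <= n * a + a - ln a]. Subtracting
   [n * s * L] leaves [- n * s' * L] plus constants, so the lower bound applies once
   [n * s' * L >= ln N + Q]; [n] is the first integer beyond [x]. *)
pose a := (s - s') * L.
have a0 : 0 < a by rewrite mulr_gt0// subr_gt0.
pose Q := a - ln a - ln A.
exists ((1 - s) / s' * `|Q| + (1 - s) * L - ln C) => N N0.
have lnN : 0 <= ln N%:R :> R by rewrite ln_ge0// ler1n.
pose x := (ln N%:R + `|Q|) / (s' * L).
have sL : 0 < s' * L by rewrite mulr_gt0.
have x0 : 0 <= x by rewrite divr_ge0 ?addr_ge0 ?(ltW sL).
pose n := (Num.truncn x).+1.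
have [xn nx] : x < n%:R /\ n%:R <= x + 1.
  have := truncn_itv x0; rewrite -natr1 => /andP[t1 t2].
  by split=> //; lra.
have lnn : ln n.+1%:R < n%:R * a + a - ln a :> R.
  have na : 0 < n.+1%:R * a by rewrite mulr_gt0.
  have := ln_sublinear na; rewrite lnM ?posrE// -natr1; lra.
have xE : x * (s' * L) = ln N%:R + `|Q| by rewrite divfK ?gt_eqF.
have Vlow : ((C * (eta ^+ n) `^ (1 - s))%:E <= Vnr nu N r)%E.
  apply: lowerP; rewrite ler_lnE ?mulr_gt0// ?ltr0n// !lnM ?posrE ?mulr_gt0 ?ltr0n//.
  rewrite ln_eta; have := ler_norm Q.
  have : x * (s' * L) <= n%:R * (s' * L) by rewrite ler_pM2r// ltW.
  rewrite xE; move: lnn; rewrite /Q /a; lra.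
have b0 : 0 < C * (eta ^+ n) `^ (1 - s) by rewrite mulr_gt0.
split; first by exists (C * (eta ^+ n) `^ (1 - s)).
move=> Vfin; have Vf : Vnr nu N r \is a fin_num.
  by rewrite ge0_fin_numE// (le_trans _ Vlow)// lee_fin ltW.
have VE : C * (eta ^+ n) `^ (1 - s) <= V N by rewrite -lee_fin fineK.
have := VE; rewrite ler_lnE ?(lt_le_trans b0)// lnM ?posrE// ln_eta.
have : n%:R * ((1 - s) * L) <= (x + 1) * ((1 - s) * L).
  by rewrite ler_pM2r// mulr_gt0.
have -> : (1 - s) / s' * ln N%:R + ((1 - s) / s' * `|Q| + (1 - s) * L - ln C) =
    (x + 1) * ((1 - s) * L) - ln C.
  by rewrite /x; field; rewrite !gt_eqF.
lra.
Qed.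

Let lnV_le : exists C : R, exists N0 : nat, forall N, (N0 <= N)%N ->
  [/\ (0 < N)%N, (Vnr nu N r < +oo)%E & (1 - s) / s * ln N%:R - C <= - ln (V N)].
Proof.
have [C [A [C0 A0 upperP]]] := upper.
have [n0 n0P] := archi A.
(* Any exponent below [s] would do: only the positivity of the error is drawn from [lnV_ge]. *)
have s'P : 0 < s / 2 < s by apply/andP; split; have := s0; lra.
have [C' VP] := lnV_ge (s / 2) s'P.
exists ((1 - s) / s * ln A + (1 - s) * L + ln C), n0.+1 => N N0.
have NA : A <= N%:R by rewrite (le_trans n0P)// ler_nat ltnW.
have Npos : (0 < N)%N by exact: leq_trans N0.
pose x := (ln N%:R - ln A) / (s * L).
have sL : 0 < s * L by rewrite mulr_gt0.
have x0 : 0 <= x by rewrite divr_ge0 ?(ltW sL)// subr_ge0 -ler_lnE ?ltr0n.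
(* The largest [n] for which the upper bound applies to [N]; rounding costs the constant
   [(1 - s) * L]. *)
pose n := Num.truncn x.
have /andP[nx xn] := truncn_itv x0; rewrite -/n -natr1 in nx xn.
have xE : x * (s * L) = ln N%:R - ln A by rewrite divfK ?gt_eqF.
have Vup : (Vnr nu N r <= (C * (eta ^+ n) `^ (1 - s))%:E)%E.
  apply: upperP; rewrite ler_lnE ?mulr_gt0 ?ltr0n// lnM ?posrE ?ltr0n// ln_eta.
  have : n%:R * (s * L) <= x * (s * L) by rewrite ler_pM2r.
  rewrite xE; lra.
have Vfin : (Vnr nu N r < +oo)%E by rewrite (le_lt_trans Vup)// ltry.
have [[b b0 bV] _] := VP N Npos.
have Vf : Vnr nu N r \is a fin_num.
  by rewrite ge0_fin_numE// (le_trans _ bV)// lee_fin ltW.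
have V0 : 0 < V N by rewrite (lt_le_trans b0)// -lee_fin fineK.
split=> //.
have VE : V N <= C * (eta ^+ n) `^ (1 - s) by rewrite -lee_fin fineK.
have := VE; rewrite ler_lnE ?mulr_gt0// lnM ?posrE// ln_eta.
have : x * ((1 - s) * L) <= (n%:R + 1) * ((1 - s) * L).
  by rewrite ler_pM2r ?mulr_gt0// ltW.
have -> : (1 - s) / s * ln N%:R - ((1 - s) / s * ln A + (1 - s) * L + ln C) =
    x * ((1 - s) * L) - (1 - s) * L - ln C.
  by rewrite /x; field; rewrite !gt_eqF.
lra.
Qed.

Lemma quant_dim_of_Vnr_bounds : quant_dim nu r (r * (s / (1 - s))).
Proof.
pose kappa := (1 - s) / s.
have kappa0 : 0 < kappa by rewrite divr_gt0.
suff lim : - ln (V N) / ln N%:R @[N --> \oo] --> kappa.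
  have -> : r * (s / (1 - s)) = r * kappa^-1 by rewrite invf_div.
  rewrite /quant_dim.
  suff -> : (fun n : nat => ln n%:R / - ln (enr nu n r)) =
      (fun n => r * (- ln (V n) / ln n%:R)^-1).
    by apply: cvgMr; apply: cvgV => //; rewrite gt_eqF.
  apply/funext => n; rewrite /enr ln_powR -/(V n) invf_div.
  (* In this degenerate case both sides are 0, the inverse of 0 being 0. *)
  have [->|lnV0] := eqVneq (ln (V n)) 0; first by rewrite mulr0 oppr0 !invr0 !mulr0.
  by field; rewrite lnV0 gt_eqF.
apply/cvgrPdist_lt => eps eps0.
have [C [N0 leP]] := lnV_le.
(* Solves [(1 - s) / s' = kappa + eps / 2]; the other half of [eps] absorbs the constants [C] and
   [C'] once [ln N] is at least [X]. *)
pose s' := (1 - s) / (kappa + eps / 2).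
have ke0 : 0 < kappa + eps / 2 by rewrite addr_gt0// divr_gt0.
have s'P : 0 < s' < s.
  rewrite divr_gt0//= ltr_pdivrMr// mulrDr /kappa mulrCA mulfV ?gt_eqF// mulr1.
  by rewrite ltrDl mulr_gt0// divr_gt0.
have [C' geP] := lnV_ge s' s'P.
have s'E : (1 - s) / s' = kappa + eps / 2.
  by rewrite invf_div mulrCA mulfV ?gt_eqF// mulr1.
pose X := 1 + (`|C| + `|C'|) * 2 / eps.
have [N1 N1P] := archi (expR X).
exists (maxn N0 N1) => // N /=; rewrite geq_max => /andP[/leP[Npos Vfin Vle] NN1].
have [_ /(_ Vfin) Vge] := geP N Npos.
have XN : X <= ln N%:R.
  rewrite -[X]expRK ler_ln ?posrE ?expR_gt0 ?ltr0n//.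
  by rewrite (le_trans N1P)// ler_nat.
have X1 : 1 <= X by rewrite lerDl mulr_ge0 ?invr_ge0 ?(ltW eps0)// mulr_ge0 ?addr_ge0.
have lnN0 : 0 < ln N%:R :> R by exact: lt_le_trans (lt_le_trans ltr01 X1) XN.
have small : `|C| + `|C'| < ln N%:R * (eps / 2).
  apply: (@lt_le_trans _ _ (X * (eps / 2))); last by rewrite ler_pM2r// divr_gt0.
  rewrite /X mulrDl mul1r -[ltLHS]add0r ltr_leD// ?divr_gt0//.
  by rewrite le_eqVlt; apply/orP; left; apply/eqP; field; rewrite gt_eqF.
rewrite s'E in Vge.
have -> : kappa - - ln (V N) / ln N%:R = (kappa * ln N%:R + ln (V N)) / ln N%:R.
  by field; rewrite gt_eqF.
rewrite normrM [`|(_^-1)|]gtr0_norm ?invr_gt0// ltr_pdivrMr// ltr_norml.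
have := ler_norm C; have := ler_norm C'; rewrite -/kappa in Vle.
have := normr_ge0 C; have := normr_ge0 C'.
by move=> ? ? ? ?; apply/andP; split; lra.
Qed.

End Asymptotics.

(** * The exponent equation and its comparison for products *)

Lemma powR_in01 {R : realType} (x r : R) : 0 < x < 1 -> 0 < r -> 0 < x `^ r < 1.
Proof.
move=> /andP[x0 x1] r0; rewrite powR_gt0//=.
suff : x `^ r < 1 `^ r by rewrite powR1.
by rewrite gt0_ltr_powR// nnegrE ltW.
Qed.

Section MoranExponent.
Context {R : realType} {K : finType}.

(** Intermediate values: the sum is the cardinal of [K] at exponent 0 and is below 1 at exponent 1.
    Writing powers through [expR] makes continuity in the exponent immediate. *)
Lemma exists_moran_exponent (h : K -> R) :
  (forall k, 0 < h k) -> \sum_k h k < 1 -> (1 < #|K|)%N ->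
  exists2 s : R, 0 < s < 1 & \sum_k h k `^ s = 1.
Proof.
move=> h0 h1 K1; pose F (x : R) := \sum_k expR (x * ln (h k)).
have FE x : F x = \sum_k h k `^ x.
  by apply: eq_bigr => k _; rewrite /powR gt_eqF.
have F0 : 1 < F 0.
  rewrite FE; under eq_bigr do rewrite powRr0.
  by rewrite sumr_const ltr1n.
have F1 : F 1 < 1.
  by rewrite FE; under eq_bigr => k _ do rewrite powRr1 ?(ltW (h0 k))//.
have cF : continuous F.
  have -> : F = fun x => \sum_(k <- index_enum K) expR (x * ln (h k)) by [].
  elim: (index_enum K) => [|k l IH] x.
    by under eq_fun do rewrite big_nil; exact: cvg_cst.
  under eq_fun do rewrite big_cons.
  apply: cvgD; last exact: IH.
  apply: (@continuous_comp _ _ _ (fun x : R => x * ln (h k)) (@expR R)).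
    by apply: cvgMl; exact: cvg_id.
  exact: continuous_expR.
have [] := @IVT R F 0 1 1 ler01.
- exact: continuous_subspaceT.
- by rewrite ge_min (ltW F1) orbT le_max (ltW F0).
move=> s; rewrite in_itv/= => /andP[s0 s1] Fs; exists s; last by rewrite -FE.
rewrite !lt_neqAle s0 s1 !andbT; apply/andP; split.
  by apply: contraTneq F0 => ->; rewrite Fs ltxx.
by apply: contraTneq F1 => E; rewrite -[X in F X]E Fs ltxx.
Qed.

End MoranExponent.

Lemma pos_prob_lt1 {R : realType} {N : nat} (p : 'I_N -> R) :
  (2 <= N)%N -> pos_prob_vector p -> forall i, p i < 1.
Proof.
move=> N2 [p0 p1] i; rewrite -p1 (bigD1 i)//= ltrDl.
have /card_gt0P[j] : (0 < #|predC1 i|)%N.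
  by have := cardC1 i; rewrite card_ord => ->; case: N N2 {p p0 p1 i} => [|[]].
rewrite inE => ji; rewrite (bigD1 j)//= ltr_pwDl//.
by apply: sumr_ge0 => l _; exact: ltW.
Qed.

(** If [t <= s], the double sum at [s] is at most 1, all bases being at most 1. It factors, however,
    into the sum for [p], equal to 1, and the sum of the powers of the [q j], which exceeds 1
    because every [q j] is below 1. *)
Lemma moran_exponent_lt {R : realType} {N : nat} (p q : 'I_N -> R) (eta s t : R) :
  (2 <= N)%N -> pos_prob_vector p -> pos_prob_vector q -> 0 < eta < 1 ->
  0 < s < 1 -> \sum_i (p i * eta) `^ s = 1 ->
  \sum_i \sum_j (p i * q j * eta) `^ t = 1 -> s < t.
Proof.
move=> N2 pP qP /andP[eta0 eta1] /andP[s0 s1] sump sumpq.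
have [p0 _] := pP; have [q0 q1] := qP.
have plt := pos_prob_lt1 p N2 pP; have qlt := pos_prob_lt1 q N2 qP.
rewrite ltNge; apply/negP => ts.
have : \sum_i \sum_j (p i * q j * eta) `^ s <= 1.
  rewrite -[leRHS]sumpq; apply: ler_sum => i _; apply: ler_sum => j _.
  apply: ger_powR => //; rewrite !mulr_gt0//=.
  by rewrite !mulr_ile1 ?mulr_ge0// ?ltW.
apply/negP; rewrite -ltNge.
have -> : \sum_i \sum_j (p i * q j * eta) `^ s = \sum_j q j `^ s.
  rewrite -[RHS]mul1r -[X in X * _]sump mulr_suml; apply: eq_bigr => i _.
  rewrite mulr_sumr; apply: eq_bigr => j _.
  by rewrite mulrAC [LHS]powRM ?mulr_ge0 ?(ltW (p0 i)) ?(ltW (q0 j)) ?(ltW eta0).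
have qs j : q j < q j `^ s.
  rewrite -ltr_ln ?posrE ?powR_gt0// ln_powR -subr_lt0.
  rewrite -[X in X - _]mul1r -mulrBl pmulr_rlt0 ?subr_gt0//.
  by rewrite ln_lt0// q0 qlt.
have j0 : 'I_N by exact: Ordinal (ltn_trans (ltnSn 0) N2).
rewrite -q1; apply: ltr_sum => [|j _]; last exact: qs.
by apply/hasP; exists j0; rewrite ?mem_index_enum.
Qed.

Theorem quant_dim_self_similar {R : realType} {m : nat} {K : finType}
    (theta : K -> 'rV[R]_m -> 'rV[R]_m) (c r s : R) (w : K -> R)
    (nu : probability (Rd R m) R) :
  0 < c < 1 -> 0 < r -> (forall k, similarity c (theta k)) ->
  open_set_condition theta -> (forall k, 0 < w k) -> \sum_k w k = 1 ->
  invariant_measure theta w nu ->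
  0 < s < 1 -> \sum_k (w k * c `^ r) `^ s = 1 ->
  quant_dim nu r (r * (s / (1 - s))).
Proof.
move=> c01 r0 sim osc w0 w1 inv s01 sum_s.
have /andP[c0 c1] := c01.
apply: (quant_dim_of_Vnr_bounds (eta := c `^ r)) => //.
- exact: powR_in01.
- exact: Vnr_upper_bound sum_s.
- exact: Vnr_lower_bound sum_s osc.
Qed.

(** * Similarity and the open set condition for the product system *)

Section ProductSystem.
Context {R : realType} {d N : nat} {c : R}.
Context {f g : 'I_N -> 'rV[R]_d -> 'rV[R]_d}.

Lemma dotr_row_mx (a b : 'rV[R]_d) :
  dotr (row_mx a b) (row_mx a b) = dotr a a + dotr b b.
Proof.
rewrite /dotr big_split_ord /=; congr (_ + _).
  by apply: eq_bigr => i _; rewrite row_mxEl.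
by apply: eq_bigr => i _; rewrite row_mxEr.
Qed.

Lemma row_mxB (a b a' b' : 'rV[R]_d) :
  row_mx a b - row_mx a' b' = row_mx (a - a') (b - b').
Proof. by rewrite opp_row_mx add_row_mx. Qed.

Lemma similarity_prod_map : 0 < c ->
  (forall i, similarity c (f i)) -> (forall i, similarity c (g i)) ->
  forall ij, similarity c (prod_map f g ij).
Proof.
move=> c0 sf sg ij z z'.
have -> : enorm (z - z') = enorm (row_mx (lsubmx z - lsubmx z') (rsubmx z - rsubmx z')).
  by rewrite -row_mxB !hsubmxK.
rewrite /prod_map row_mxB; apply/eqP.
rewrite -(@eqrXn2 _ 2) ?mulr_ge0 ?enorm_ge0 ?(ltW c0)// exprMn !sqr_enorm !dotr_row_mx.
by rewrite -!sqr_enorm sf sg !exprMn mulrDr.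
Qed.

(** The product of the two open sets works: distinct pairs of indices differ in some coordinate, and
    there the images are disjoint. *)
Lemma OSC_prod_map : OSC f -> OSC g -> open_set_condition (prod_map f g).
Proof.
move=> [U [oU [x Ux] fU dU]] [V [oV [y Vy] gV dV]].
exists [set z | U (lsubmx z) /\ V (rsubmx z)]; split.
- apply/open_enormP => z [Uz Vz].
  have /open_enormP/(_ _ Uz)[e e0 eU] := oU.
  have /open_enormP/(_ _ Vz)[e' e'0 eV] := oV.
  exists (Num.min e e'); first by rewrite lt_min e0.
  move=> z'; rewrite lt_min => /andP[ze ze'].
  have zE : z' - z = row_mx (lsubmx z' - lsubmx z) (rsubmx z' - rsubmx z).
    by rewrite -row_mxB !hsubmxK.
  split; [apply: eU; apply: le_lt_trans ze|apply: eV; apply: le_lt_trans ze'];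
    rewrite zE -ler_sqr ?nnegrE ?enorm_ge0// !sqr_enorm dotr_row_mx -!sqr_enorm.
  + by rewrite lerDl sqr_ge0.
  + by rewrite lerDr sqr_ge0.
- by exists (row_mx x y); rewrite /= row_mxKl row_mxKr.
- move=> ij _ [z [Uz Vz] <-]; rewrite /prod_map /= row_mxKl row_mxKr.
  by split; [apply: (fU ij.1); exists (lsubmx z)|apply: (gV ij.2); exists (rsubmx z)].
- move=> [i j] [i' j'] ij; apply/seteqP; split=> // z.
  move=> [[a [Ua Va] <-] [b [Ub Vb] E]]; move: E; rewrite /prod_map /= => /eq_row_mx[E1 E2].
  have [ii|ii] := eqVneq i i'.
    have jj : j != j' by apply: contraNneq ij => ->; rewrite ii.
    suff : (g j @` V `&` g j' @` V) (g j (rsubmx a)) by rewrite (dV j j' jj).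
    split; first by exists (rsubmx a).
    by exists (rsubmx b).
  suff : (f i @` U `&` f i' @` U) (f i (lsubmx a)) by rewrite (dU i i' ii).
  split; first by exists (lsubmx a).
  by exists (lsubmx b).
Qed.

End ProductSystem.

Theorem mainTheorem12 (R : realType) (d N : nat) (c : R)
  (f g : 'I_N -> 'rV[R]_d -> 'rV[R]_d) (p q : 'I_N -> R)
  (muF muG : probability (Rd R d) R) (muFG : probability (Rd R (d + d)) R) :
  (2 <= N)%N -> 0 < c < 1 ->
  (forall i, similarity c (f i)) -> (forall i, similarity c (g i)) ->
  pos_prob_vector p -> pos_prob_vector q ->
  invariant_measure f p muF -> invariant_measure g q muG ->
  invariant_measure (prod_map f g) (fun ij => p ij.1 * q ij.2) muFG ->
  OSC f -> OSC g ->
  forall r : R, 0 < r ->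
    exists Dstar Dprime D : R,
      [/\ quant_dim muF r Dstar, quant_dim muG r Dprime, quant_dim muFG r D
        & Num.max Dstar Dprime < D].
Proof.
move=> N2 c01 sf sg pP qP invF invG invFG oscF oscG r r0.
have [p0 p1] := pP; have [q0 q1] := qP; have /andP[c0 c1] := c01.
have eta01 : 0 < c `^ r < 1 by exact: powR_in01.
have /andP[eta0 eta1] := eta01.
have exponent (K : finType) (w : K -> R) : (forall k, 0 < w k) ->
    \sum_k w k = 1 -> (1 < #|K|)%N ->
    exists2 s, 0 < s < 1 & \sum_k (w k * c `^ r) `^ s = 1.
  move=> w0 w1 K1; apply: exists_moran_exponent => // [k|]; first by rewrite mulr_gt0.
  by rewrite -mulr_suml w1 mul1r.
have [sF sF01 sFE] := exponent _ p p0 p1 ltac:(by rewrite card_ord).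
have [sG sG01 sGE] := exponent _ q q0 q1 ltac:(by rewrite card_ord).
pose w (ij : 'I_N * 'I_N) := p ij.1 * q ij.2.
have w0 ij : 0 < w ij by rewrite mulr_gt0.
have w1 : \sum_ij w ij = 1.
  rewrite -(pair_bigA _ (fun i j => p i * q j)) /= -[RHS]p1; apply: eq_bigr => i _.
  by rewrite -mulr_sumr q1 mulr1.
have [s s01 sE] := exponent _ w w0 w1
  ltac:(by rewrite card_prod card_ord (leq_trans N2)// leq_pmulr// ltnW).
have sE' : \sum_i \sum_j (p i * q j * c `^ r) `^ s = 1.
  by rewrite (pair_bigA _ (fun i j => (p i * q j * c `^ r) `^ s)).
have sFs : sF < s := moran_exponent_lt p q _ _ _ N2 pP qP eta01 sF01 sFE sE'.
have sGs : sG < s.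
  apply: (moran_exponent_lt q p _ _ _ N2 qP pP eta01 sG01 sGE).
  (* The roles of [p] and [q] are exchanged by swapping the two sums. *)
  rewrite -[RHS]sE' exchange_big /=; apply: eq_bigr => i _; apply: eq_bigr => j _.
  by rewrite [q j * _]mulrC.
(* Dimensions compare as exponents do, because [t / (1 - t)] increases on the open unit interval. *)
have D_lt t : 0 < t < 1 -> t < s -> r * (t / (1 - t)) < r * (s / (1 - s)).
  move=> /andP[t0 t1] ts; have /andP[s0 s1] := s01.
  rewrite ltr_pM2l// ltr_pdivrMr ?subr_gt0// mulrAC ltr_pdivlMr ?subr_gt0//.
  by rewrite !mulrBr !mulr1 [s * t]mulrC ltrD2r.
exists (r * (sF / (1 - sF))), (r * (sG / (1 - sG))), (r * (s / (1 - s))); split.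
- exact: quant_dim_self_similar sf oscF p0 p1 invF sF01 sFE.
- exact: quant_dim_self_similar sg oscG q0 q1 invG sG01 sGE.
- exact: quant_dim_self_similar (similarity_prod_map c0 sf sg) (OSC_prod_map oscF oscG)
    w0 w1 invFG s01 sE.
- by rewrite gt_max !D_lt.
Qed.
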